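(* Let $\alpha_0,\dots,\alpha_4$ be complex parameters with $\alpha_0+\alpha_1+2\alpha_2+\alpha_3+\alpha_4=1$. For the system of type $D_4^{(1)}$ $$\frac{dx}{dt}=\frac{2x^2y-x^2+(\alpha_0+\alpha_1)x-2w}{t}+1,\qquad \frac{dy}{dt}=\frac{-2xy^2+2xy-(\alpha_0+\alpha_1)y+\alpha_1}{t},$$ $$\frac{dz}{dt}=\frac{2z^2w-tz^2-(1-\alpha_3-\alpha_4)z+1-2y}{t},\qquad \frac{dw}{dt}=\frac{-2zw^2+2tzw+(1-\alpha_3-\alpha_4)w+\alpha_3t}{t},$$ make the change of parameters and variables $$A_0=\alpha_0,\quad A_1=\alpha_1,\quad A_2=\alpha_2,\quad A_3=\alpha_3,\quad A_4=\frac{\alpha_4-\alpha_3}{2},$$ $$X=x,\quad Y=y,\quad Z=\frac1z,\quad W=-(zw+\alpha_3)z.$$ Then the system can also be written in the new variables $X,Y,Z,W$ and parameters $A_0,\dots,A_4$ as a Hamiltonian system, and this new system coincides with the system of type $B_4^{(1)}$ $$\frac{dX}{dt}=\frac{\partial \tilde H_{B_4^{(1)}}}{\partial Y},\quad \frac{dY}{dt}=-\frac{\partial \tilde H_{B_4^{(1)}}}{\partial X},\quad \frac{dZ}{dt}=\frac{\partial \tilde H_{B_4^{(1)}}}{\partial W},\quad \frac{dW}{dt}=-\frac{\partial \tilde H_{B_4^{(1)}}}{\partial Z}$$ with the Hamiltonian $$t\tilde H_{B_4^{(1)}}=X^2Y(Y-1)+X\{(A_0+A_1)Y-A_1\}+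tY+Z^2W(W-1)+Z\{(1-2A_4)W-A_3\}+tW+2YZ(ZW+A_3).$$
   Context: The system of type $D_4^{(1)}$ is the Hamiltonian system $dx/dt=\partial H/\partial y$, $dy/dt=-\partial H/\partial x$, $dz/dt=\partial H/\partial w$, $dw/dt=-\partial H/\partial z$ with $tH=x^2y(y-1)+x\{(\alpha_0+\alpha_1)y-\alpha_1\}+ty+z^2w(w-t)-z\{(1-\alpha_3-\alpha_4)w+\alpha_3t\}+w-2yw$. The parameters of the target system satisfy $A_0+A_1+2A_2+2A_3+2A_4=1$. *)

(* Defs.v *)
From HB Require Import structures.
From mathcomp Require Import all_boot all_order all_algebra complex.
From mathcomp Require Import all_classical all_reals all_analysis.
Import numFieldNormedType.Exports GRing.Theory.

Set Implicit Arguments.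
Unset Strict Implicit.
Unset Printing Implicit Defensive.

Local Open Scope classical_set_scope.
Local Open Scope ring_scope.

(* The complex numbers as a structure rather than as the bare type R[i], so
   that they carry the topology and norm of a numFieldType; a derivative on
   Cplx R is therefore a complex derivative. *)
Definition Cplx (R : realType) : numClosedFieldType := complex R.

Section Systems.
Variable R : realType.
Notation C := (Cplx R).

(* [x, y, z, w] is a holomorphic solution on the open set [U] of the
   non-autonomous Hamiltonian system with canonical pairs (x, y) and (z, w);
   the arguments of [H] are the time followed by x, y, z, w. *)
Definition hamiltonian_system (H : C -> C -> C -> C -> C -> C)
    (U : set C) (x y z w : C -> C) : Prop :=
  forall t, U t ->
  [/\ is_derive t 1 x (derive1 (fun v => H t (x t) v (z t) (w t)) (y t)),
      is_derive t 1 y (- derive1 (fun u => H t u (y t) (z t) (w t)) (x t)),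
      is_derive t 1 z (derive1 (fun v => H t (x t) (y t) (z t) v) (w t)) &
      is_derive t 1 w (- derive1 (fun u => H t (x t) (y t) u (w t)) (z t))].

Definition D4_system (a0 a1 a3 a4 : C)
    (U : set C) (x y z w : C -> C) : Prop :=
  forall t, U t ->
  [/\ is_derive t 1 x
        ((2 * x t ^+ 2 * y t - x t ^+ 2 + (a0 + a1) * x t - 2 * w t) / t + 1),
      is_derive t 1 y
        ((- 2 * x t * y t ^+ 2 + 2 * x t * y t - (a0 + a1) * y t + a1) / t),
      is_derive t 1 z
        ((2 * z t ^+ 2 * w t - t * z t ^+ 2 - (1 - a3 - a4) * z t
          + 1 - 2 * y t) / t) &
      is_derive t 1 w
        ((- 2 * z t * w t ^+ 2 + 2 * t * z t * w t + (1 - a3 - a4) * w t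
          + a3 * t) / t)].

Definition H_B4 (A0 A1 A3 A4 : C) (t X Y Z W : C) : C :=
  (X ^+ 2 * Y * (Y - 1) + X * ((A0 + A1) * Y - A1) + t * Y
   + Z ^+ 2 * W * (W - 1) + Z * ((1 - 2 * A4) * W - A3) + t * W
   + 2 * Y * Z * (Z * W + A3)) / t.

Definition change_of_variables (a3 x y z w X Y Z W : C) : Prop :=
  [/\ z != 0, X = x, Y = y, Z = z^-1 & W = - (z * w + a3) * z].

End Systems.

(* Main.v *)
(** The change of variables [(z, w) |-> (1/z, -(z w + a3) z)] is an involution
    of [{z != 0}]; both implications therefore come from one computation of
    the derivatives of the new variables, followed by identities between
    rational functions. *)
Require Import Defs.
From HB Require Import structures.
From mathcomp Require Import all_boot all_order all_algebra complex.
From mathcomp Require Import all_classical all_reals all_analysis.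
From mathcomp Require Import ring.
Import numFieldNormedType.Exports GRing.Theory.

Local Open Scope classical_set_scope.
Local Open Scope ring_scope.

(** [H_B4] has degree at most two in each canonical variable separately, so this single rule yields
    all four partial derivatives. *)
Lemma derive1_quadratic (K : numFieldType) (f : K -> K) (a b c x : K) :
  (forall v, f v = a * v ^+ 2 + b * v + c) -> derive1 f x = 2 * a * x + b.
Proof.
move=> fE; have -> : f = cst a * id ^+ 2 + cst b * id + cst c.
  by apply/funext => v; rewrite fE.
by rewrite derive1E derive_val /GRing.scale /=; ring.
Qed.

Section HamiltonianB4.
Variables (R : realType) (A0 A1 A3 A4 t X Y Z W : Cplx R).
Local Notation H := (H_B4 A0 A1 A3 A4 t).

Lemma derive1_H_B4_X : derive1 (fun u => H u Y Z W) X =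
  (2 * X * Y * (Y - 1) + (A0 + A1) * Y - A1) / t.
Proof.
(* The constant coefficient is given as the value of the Hamiltonian at 0, here [H 0 Y Z W], instead
   of being written out. *)
rewrite (@derive1_quadratic _ _ (Y * (Y - 1) / t) (((A0 + A1) * Y - A1) / t)
  (H 0 Y Z W)); first by ring.
by move=> v; rewrite /H_B4; ring.
Qed.

Lemma derive1_H_B4_Y : derive1 (fun v => H X v Z W) Y =
  (X ^+ 2 * (2 * Y - 1) + (A0 + A1) * X + t + 2 * Z * (Z * W + A3)) / t.
Proof.
rewrite (@derive1_quadratic _ _ (X ^+ 2 / t)
  ((- X ^+ 2 + (A0 + A1) * X + t + 2 * Z * (Z * W + A3)) / t)
  (H X 0 Z W)); first by ring.
by move=> v; rewrite /H_B4; ring.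
Qed.

Lemma derive1_H_B4_Z : derive1 (fun u => H X Y u W) Z =
  (2 * Z * W * (W - 1) + (1 - 2 * A4) * W - A3
   + 4 * Y * Z * W + 2 * A3 * Y) / t.
Proof.
rewrite (@derive1_quadratic _ _ ((W * (W - 1) + 2 * Y * W) / t)
  (((1 - 2 * A4) * W - A3 + 2 * A3 * Y) / t) (H X Y 0 W)); first by ring.
by move=> v; rewrite /H_B4; ring.
Qed.

Lemma derive1_H_B4_W : derive1 (fun v => H X Y Z v) W =
  (Z ^+ 2 * (2 * W - 1) + (1 - 2 * A4) * Z + t + 2 * Y * Z ^+ 2) / t.
Proof.
rewrite (@derive1_quadratic _ _ (Z ^+ 2 / t)
  ((- Z ^+ 2 + (1 - 2 * A4) * Z + t + 2 * Y * Z ^+ 2) / t)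
  (H X Y Z 0)); first by ring.
by move=> v; rewrite /H_B4; ring.
Qed.

End HamiltonianB4.

(** From [Z * W = - (z * w + a)] follows [Z * W + a = - z * w], hence [- (Z * W + a) * Z = w], with
    the same parameter [a]. *)
Lemma change_of_variables_sym (R : realType) (a x y z w X Y Z W : Cplx R) :
  change_of_variables a x y z w X Y Z W ->
  change_of_variables a X Y Z W x y z w.
Proof.
move=> [z0 -> -> -> ->]; split=> //; first by rewrite invr_eq0.
  by rewrite invrK.
by field.
Qed.

(** Chain rule for the substitution. The derivatives [dx], ..., [dw] are arbitrary, so that it
    serves both directions of the equivalence. *)
Lemma is_derive_change_of_variables (R : realType) (a : Cplx R)
    (U : set (Cplx R)) (x y z w X Y Z W : Cplx R -> Cplx R)
    (t dx dy dz dw : Cplx R) :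
  open U -> U t ->
  (forall s, U s -> change_of_variables a
     (x s) (y s) (z s) (w s) (X s) (Y s) (Z s) (W s)) ->
  is_derive t 1 x dx -> is_derive t 1 y dy ->
  is_derive t 1 z dz -> is_derive t 1 w dw ->
  [/\ is_derive t 1 X dx, is_derive t 1 Y dy,
      is_derive t 1 Z (- dz / z t ^+ 2) &
      is_derive t 1 W (- (2 * z t * w t + a) * dz - z t ^+ 2 * dw)].
Proof.
move=> oU Ut cv xt yt zt wt.
(* The substitution holds only on [U]; since [U] is open it holds near [t], which is enough to
   transfer derivatives. *)
have nearU f g : (forall s, U s -> f s = g s) -> \near t, f t = g t.
  by move=> fg; apply: filterS (open_nbhs_nbhs (conj oU Ut)) => s /fg.
have [zt0 _ _ _ _] := cv t Ut.
split.
- by apply: near_eq_is_derive xt; apply: nearU => s /cv[].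
- by apply: near_eq_is_derive yt; apply: nearU => s /cv[].
- apply: (@near_eq_is_derive _ _ _ (fun s => (z s)^-1)).
    by apply: nearU => s /cv[].
  split; first exact: derivableV.
  by rewrite deriveV // derive_val /GRing.scale /=; field.
- apply: (@near_eq_is_derive _ _ _ (- (z * w + cst a) * z)).
    by apply: nearU => s /cv[].
  by apply: is_derive_eq; rewrite /GRing.scale /= !fctE; ring.
Qed.

Arguments is_derive_change_of_variables {R a U x y z w X Y Z W t dx dy dz dw}.

Theorem theorem3p6 (R : realType)
    (a0 a1 a2 a3 a4 : Cplx R)
    (ha : a0 + a1 + 2 * a2 + a3 + a4 = 1)
    (A0 A1 A2 A3 A4 : Cplx R)
    (hA0 : A0 = a0) (hA1 : A1 = a1) (hA2 : A2 = a2) (hA3 : A3 = a3)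
    (hA4 : A4 = (a4 - a3) / 2) :
  [/\ A0 + A1 + 2 * A2 + 2 * A3 + 2 * A4 = 1,
      forall X Y Z W : Cplx R, Z != 0 ->
        exists x y z w : Cplx R, change_of_variables a3 x y z w X Y Z W &
      forall (U : set (Cplx R)) (x y z w X Y Z W : Cplx R -> Cplx R),
        open U -> ~ U 0 ->
        (forall t, U t -> change_of_variables a3
           (x t) (y t) (z t) (w t) (X t) (Y t) (Z t) (W t)) ->
        D4_system a0 a1 a3 a4 U x y z w <->
        hamiltonian_system (H_B4 A0 A1 A3 A4) U X Y Z W].
Proof.
(* Eliminating [a4] rather than [A4] keeps the later identities free of division by 2. *)
have a4E : a4 = 2 * A4 + a3.
  by rewrite hA4 mulrC divfK ?subrK // Num.Theory.pnatr_eq0.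
move: ha; rewrite hA0 hA1 hA2 hA3 a4E => {}ha; split.
- by rewrite -[RHS]ha; ring.
- move=> X Y Z W Z0; exists X, Y, Z^-1, (- (Z * W + a3) * Z).
  exact: change_of_variables_sym.
- move=> U x y z w X Y Z W oU U0 cv.
  have cv' s : U s -> change_of_variables a3
      (X s) (Y s) (Z s) (W s) (x s) (y s) (z s) (w s).
    by move=> /cv; exact: change_of_variables_sym.
  split=> sys t Ut; have t0 : t != 0 by apply: contra_notN U0 => /eqP <-.
  + have [xt yt zt wt] := sys t Ut.
    have [Xt Yt Zt Wt] :=
      is_derive_change_of_variables oU Ut cv xt yt zt wt.
    have [z0 XE YE ZE WE] := cv t Ut.
    rewrite derive1_H_B4_X derive1_H_B4_Y derive1_H_B4_Z derive1_H_B4_W.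
    rewrite XE YE ZE WE; split.
    (* The coupling term [2 * Z * (Z * W + A3)] of the new Hamiltonian turns into [- 2 * w]. *)
    * by apply: is_derive_eq Xt _; field; rewrite t0 z0.
    * by apply: is_derive_eq Yt _; field.
    * by apply: is_derive_eq Zt _; field; rewrite t0 z0.
    * by apply: is_derive_eq Wt _; field; rewrite t0 z0.
  + have := sys t Ut.
    rewrite derive1_H_B4_X derive1_H_B4_Y derive1_H_B4_Z derive1_H_B4_W.
    move=> [Xt Yt Zt Wt].
    (* The same chain rule, applied to the inverse substitution [cv'] with the roles of old and new
       variables exchanged. *)
    have [xt yt zt wt] :=
      is_derive_change_of_variables oU Ut cv' Xt Yt Zt Wt.
    have [Z0 xE yE zE wE] := cv' t Ut.
    rewrite xE yE zE wE; split.
    * by apply: is_derive_eq xt _; field.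
    * by apply: is_derive_eq yt _; field.
    * by apply: is_derive_eq zt _; field; rewrite t0 Z0.
    * by apply: is_derive_eq wt _; field; rewrite t0 Z0.
Qed.
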